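(* For $n\ge2$, $$\sum_{\pi\in\mathrm{PF}(n)}x^{\mathrm{lel}(\pi)}y^{\mathrm{nlel}(\pi)}z^{\mathrm{unl}(\pi)}=xy\Big(n\prod_{i=1}^{n-2}\big(xz+yz+(i-1)z+n-i\big)+xyz\prod_{i=1}^{n-2}\big(xyz+iz+n-i\big)\Big).$$
   Context: $\mathrm{PF}(n)$ is the set of parking functions of length $n$: sequences of positive integers whose increasing rearrangement $b_1\le\dots\le b_n$ satisfies $b_i\le i$; equivalently all cars park under the classical protocol (cars $1,\dots,n$ arrive in order, car $i$ parks in the first unoccupied spot among $\pi_i,\pi_i+1,\dots,n$). $\mathrm{unl}(\pi)$ is the number of cars not parking in their preferred spot, $\mathrm{lel}(\pi)=\#\{i:\pi_i=\pi_1\}$, $\mathrm{nlel}(\pi)=\#\{i:\pi_i=\pi_2\}$. *)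

(* Defs.v *)
From mathcomp Require Import all_boot.

Set Implicit Arguments.
Unset Strict Implicit.
Unset Printing Implicit Defensive.

(* Spots and preferences are numbered from 1, positions in a sequence from 0:
   the (i+1)-st smallest preference is nth 0 (sort leq s) i. *)
Definition parking_function (s : seq nat) : bool :=
  (0 \notin s) && [forall i : 'I_(size s), nth 0 (sort leq s) i <= i.+1].

(* None when all the spots p, p + 1, ..., n are occupied. *)
Definition first_free (n : nat) (occ : seq nat) (p : nat) : option nat :=
  ohead [seq j <- iota p (n.+1 - p) | j \notin occ].

Fixpoint park (n : nat) (occ s : seq nat) : seq (option nat) :=
  if s is p :: s' then
    let o := first_free n occ p in
    o :: park n (if o is Some j then j :: occ else occ) s'
  else [::].

Definition outcome (s : seq nat) : seq (option nat) := park (size s) [::] s.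

Definition unl (s : seq nat) : nat :=
  count (fun c => c.2 != Some c.1) (zip s (outcome s)).

Definition lel (s : seq nat) : nat := count_mem (nth 0 s 0) s.

Definition nlel (s : seq nat) : nat := count_mem (nth 0 s 1) s.

Lemma parking_function_le (s : seq nat) :
  parking_function s -> all (leq^~ (size s)) s.
Proof.
case/andP=> _ /forallP bP; apply/allP=> p.
rewrite -(mem_sort leq) => /(nthP 0)[i]; rewrite size_sort => lt_i <-.
exact: leq_trans (bP (Ordinal lt_i)) lt_i.
Qed.

Definition prefs (n : nat) (t : n.-tuple 'I_n.+1) : seq nat :=
  [seq val p | p <- t].

(* By parking_function_le, bounding the preferences by n loses nothing. *)
Definition PF (n : nat) : {set n.-tuple 'I_n.+1} :=
  [set t | parking_function (prefs t)].

Lemma PF_prefsP (n : nat) (s : seq nat) :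
  reflect (exists2 t, t \in PF n & prefs t = s)
          ((size s == n) && parking_function s).
Proof.
apply: (iffP andP) => [[/eqP sz pf] | [t]]; last first.
  by rewrite inE => pf <-; rewrite size_map size_tuple.
have le_n p : p \in s -> p <= n.
  by rewrite -sz; exact: (allP (parking_function_le pf)).
have szt : size [seq (inord p : 'I_n.+1) | p <- s] == n by rewrite size_map sz.
have E : prefs (Tuple szt) = s.
  rewrite /prefs /= -map_comp -[RHS]map_id; apply/eq_in_map => p ps /=.
  by rewrite inordK // ltnS le_n.
by exists (Tuple szt); rewrite ?inE E.
Qed.

(* Main.v *)
Require Import Defs.
From mathcomp Require Import all_boot all_order all_algebra.
From mathcomp Require Import zify ring.

(* Pollak's circle: add a spot 0 after n and park on the cycle Z/(n+1).  All cars
   park, exactly one spot stays free, and the preferences form a parking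
   function iff that spot is 0; in that case nobody wraps around, so circular
   and linear parking agree.  The three statistics are invariant under rotation,
   and each rotation class contains one parking function and one sequence
   starting with 0, so one may sum over the latter.  There the k+1-st car (k >= 2)
   faces k occupied spots, among which are pi_1 and pi_2 (the cars preferring
   these are unlucky), and the sum of its contributions depends only on k and on
   whether pi_1 = pi_2. *)

Set Implicit Arguments.
Unset Strict Implicit.
Unset Printing Implicit Defensive.

Import GRing.Theory.
Local Open Scope ring_scope.

(** * Counting lemmas and an order-free description of parking functions *)

Lemma count_all2 (S T : Type) (r : S -> T -> bool) (P : pred S) (Q : pred T)
    (s : seq S) (t : seq T) :
  (forall a b, r a b -> P a -> Q b) -> all2 r s t ->
  (count P s <= count Q t)%N.
Proof.
move=> rPQ; elim: s t => [|a s IHs] [|b t] //= /andP[rab /IHs le_st].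
by rewrite leq_add //; case: (P a) (rPQ a b rab) => // ->.
Qed.

Lemma count_zip_map (S T S' T' : Type) (f : S -> S') (g : T -> T')
    (P : pred (S' * T')) (s : seq S) (t : seq T) :
  count P (zip (map f s) (map g t)) =
  count (fun u => P (f u.1, g u.2)) (zip s t).
Proof. by elim: s t => [|a s IHs] [|b t] //=; rewrite IHs. Qed.

Lemma count_uniq_range (P : pred nat) (a m : nat) (s : seq nat) :
  uniq s -> (forall i, i \in s -> P i -> (a <= i < a + m)%N) ->
  (count P s <= m)%N.
Proof.
move=> us sP; rewrite -size_filter -[leqRHS](size_iota a m).
apply: uniq_leq_size; first exact: filter_uniq.
by move=> i; rewrite mem_filter mem_iota => /andP[Pi /sP->].
Qed.

(** If the sorted entries obey the bound, the first j of them are at most j. Conversely, if the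
    entry at index i exceeded i+1, only the i entries before it could be at most i+1. *)
Lemma parking_function_count (s : seq nat) :
  reflect (0%N \notin s /\
           forall j, (0 < j <= size s)%N -> (j <= count (geq j) s)%N)
          (parking_function s).
Proof.
have cnt j : count (geq j) s = count (geq j) (sort leq s).
  by apply/permP; rewrite perm_sym perm_sort.
have srt := sort_sorted leq_total s.
have nthle i j : (i <= j < size s)%N ->
    (nth 0%N (sort leq s) i <= nth 0%N (sort leq s) j)%N.
  case/andP=> le_ij lt_j; apply: (sorted_leq_nth leq_trans leqnn) => //;
    rewrite inE size_sort //; exact: leq_ltn_trans le_ij lt_j.
apply: (iffP andP) => -[s0 H]; split=> //.
  case=> // j /= lt_j; rewrite cnt -(cat_take_drop j.+1 (sort leq s)) count_cat.
  suff /eqP-> : count (geq j.+1) (take j.+1 (sort leq s)) == j.+1.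
    exact: leq_addr.
  have szt : size (take j.+1 (sort leq s)) = j.+1.
    by rewrite size_takel // size_sort.
  rewrite -[X in _ == X]szt -all_count; apply/(all_nthP 0%N) => i.
  rewrite szt => lt_i; rewrite nth_take //=.
  apply: leq_trans (nthle i j _) _; first by rewrite -ltnS lt_i.
  exact: (forallP H (Ordinal lt_j)).
apply/forallP=> -[i lt_i] /=; rewrite leqNgt; apply/negP=> lt_nth.
have := H i.+1 lt_i; rewrite cnt -(cat_take_drop i (sort leq s)) count_cat.
have -> : count (geq i.+1) (drop i (sort leq s)) = 0%N.
  apply/eqP; rewrite -leqn0 leqNgt -has_count; apply/hasPn => p.
  case/(nthP 0%N)=> k; rewrite size_drop size_sort nth_drop => lt_k <- /=.
  by rewrite -ltnNge (leq_trans lt_nth) // nthle // leq_addr -ltn_subRL.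
rewrite addn0 => le_i; have := leq_trans le_i (count_size _ _).
by rewrite size_takel ?ltnn // size_sort ltnW.
Qed.

(** * Parking on the cycle and its comparison with the line *)

Section CircularParking.

Variable n : nat.
Implicit Types (p q c e : 'I_n.+1) (occ s : seq 'I_n.+1).

(** Addition in ['I_n.+1] is modulo n+1, so the search wraps around. When every spot is occupied,
    [find] returns n+1 and the value is the junk [p]. *)
Definition cstep occ p : 'I_n.+1 :=
  p + inZp (find (fun k => p + inZp k \notin occ) (iota 0 n.+1)).

Fixpoint cpark occ s : seq 'I_n.+1 :=
  if s is p :: s' then cstep occ p :: cpark (cstep occ p :: occ) s' else [::].

Definition cunl occ s : nat := count (fun u => u.2 != u.1) (zip s (cpark occ s)).

Lemma cstepP occ p q : q \notin occ ->
  exists k, [/\ cstep occ p = p + inZp k, p + inZp k \notin occ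
    & forall i, (i < k)%N -> p + inZp i \in occ].
Proof.
move=> qocc; set P := fun k => p + inZp k \notin occ.
have hasP : has P (iota 0 n.+1).
  (* [q - p] is the number of steps from [p] forward to the free spot [q]. *)
  apply/hasP; exists (val (q - p)); first by rewrite mem_iota ltn_ord.
  by rewrite /P valZpK addrC subrK.
have lt_k : (find P (iota 0 n.+1) < n.+1)%N.
  by rewrite -{2}(size_iota 0 n.+1) -has_find.
exists (find P (iota 0 n.+1)); split => //.
  by have := nth_find 0%N hasP; rewrite nth_iota.
move=> i lt_i; have := before_find 0%N lt_i.
by rewrite nth_iota ?(ltn_trans lt_i) // => /negbFE.
Qed.

Lemma val_addZp p (k : nat) : (p + k < n.+1)%N -> val (p + inZp k) = (p + k)%N.
Proof. by move=> lt_pk; rewrite /= modnDmr modn_small. Qed.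

Lemma cstep_notin occ p q : q \notin occ -> cstep occ p \notin occ.
Proof. by case/(cstepP p)=> k [->]. Qed.

Lemma cstep_neq occ p q : q \notin occ -> (cstep occ p != p) = (p \in occ).
Proof.
move=> qocc; apply/idP/idP => [|pocc]; last first.
  by apply/eqP => E; have := cstep_notin p qocc; rewrite E pocc.
have [[|k] [-> _ before]] := cstepP p qocc.
  by rewrite (_ : inZp 0 = 0) ?addr0 ?eqxx //; apply: val_inj; rewrite /= mod0n.
move=> _; have := before 0%N isT.
by rewrite (_ : inZp 0 = 0) ?addr0 //; apply: val_inj; rewrite /= mod0n.
Qed.

(** The walk from [p] meets the free spot [e] after [e - p] steps, before it can wrap around. *)
Lemma cstep_between occ p e : e \notin occ -> (p <= e)%N ->
  (p <= cstep occ p <= e)%N.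
Proof.
move=> eocc le_pe; have [k [-> _ before]] := cstepP p eocc.
have le_k : (k <= e - p)%N.
  rewrite leqNgt; apply: contra eocc => /before.
  suff -> : p + inZp (e - p) = e by [].
  by apply: val_inj; rewrite val_addZp subnKC.
have le_pk : (p + k <= e)%N by rewrite -(subnKC le_pe) leq_add2l.
by rewrite val_addZp ?leq_addr // (leq_ltn_trans le_pk).
Qed.

(** A car that wraps around must first pass spot 0; as 0 is free, it would stop there. *)
Lemma cstep_linear occ p : 0 \notin occ -> cstep occ p != 0 ->
  first_free n (map val occ) p = Some (val (cstep occ p)) /\
  (0 < p <= cstep occ p)%N.
Proof.
move=> occ0 neq0; have p_gt0 : (0 < p)%N.
  rewrite lt0n; apply: contraNneq neq0 => p0.
  have {}p0 : p = 0 by apply: val_inj.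
  by have := cstep_neq p occ0; rewrite p0 (negbTE occ0) => /negbFE.
move: neq0; have [k [-> kocc before]] := cstepP p occ0 => neq0.
have lt_pk : (p + k < n.+1)%N.
  rewrite ltnNge; apply/negP => le_n.
  have wrap : p + inZp (n.+1 - p) = 0.
    by apply: val_inj; rewrite /= modnDmr subnKC ?modnn // ltnW.
  have [lt_k|ge_k|E] := ltngtP (n.+1 - p) k.
  - by move: occ0; rewrite -wrap before.
  - by move: ge_k; rewrite ltn_subRL ltnNge le_n.
  - by move: neq0; rewrite -E wrap eqxx.
have vp := val_addZp lt_pk; split; last by rewrite vp p_gt0 leq_addr.
(* Split p, ..., n at p + k: the first k spots are occupied and the next one is free. *)
have E : (n.+1 - p = k + (n - p - k).+1)%N by lia.
rewrite /first_free E iotaD filter_cat -vp.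
rewrite (_ : [seq j <- iota p k | _] = [::]).
  by have := kocc; rewrite -(mem_map val_inj) => /= ->.
apply/eqP; rewrite -[_ == _]negbK -has_filter; apply/hasPn => i.
rewrite mem_iota negbK => /andP[le_i lt_i].
have lt_ik : (i - p < k)%N by lia.
have := before _ lt_ik; rewrite -(mem_map val_inj) val_addZp ?subnKC //.
lia.
Qed.

Lemma size_cpark occ s : size (cpark occ s) = size s.
Proof. by elim: s occ => //= p s IHs occ; rewrite IHs. Qed.

Lemma ex_free occ : (size occ <= n)%N -> exists q, q \notin occ.
Proof.
move=> le_n; apply/existsP; apply: contraLR le_n.
rewrite negb_exists -ltnNge => /forallP full.
have := @uniq_leq_size _ (enum 'I_n.+1) occ (enum_uniq _).
by rewrite size_enum_ord; apply=> q _; have := full q; rewrite negbK.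
Qed.

Lemma uniq_cpark occ s : uniq occ -> (size occ + size s <= n.+1)%N ->
  uniq (cpark occ s ++ occ).
Proof.
elim: s occ => //= p s IHs occ uocc le_n.
have [|q qocc] := @ex_free occ; first lia.
have := IHs (cstep occ p :: occ); rewrite /= (cstep_notin p qocc) uocc.
rewrite -cat1s uniq_catCA /= => -> //; lia.
Qed.

(** Spot 0, free at the end, was free whenever a car parked, so [cstep_linear] applies to each
    car. *)
Lemma park_cpark occ s : 0 \notin occ -> 0 \notin cpark occ s ->
  park n (map val occ) (map val s) = [seq Some (val j) | j <- cpark occ s] /\
  all2 (fun p o : 'I_n.+1 => 0 < p <= o)%N s (cpark occ s).
Proof.
elim: s occ => //= p s IHs occ occ0; rewrite inE eq_sym => /norP[p0 s0].
have [-> le_p] := cstep_linear occ0 p0.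
have [|/= -> ->] := IHs (cstep occ p :: occ) _ s0.
  by rewrite inE eq_sym negb_or p0.
by rewrite le_p.
Qed.

(** [cstep_between] applies to each car, and strictness holds because no car takes [e]. *)
Lemma all2_cpark_between e occ s : e \notin occ -> e \notin cpark occ s ->
  all2 (fun p o : 'I_n.+1 => (p <= e) ==> (p <= o < e))%N s (cpark occ s).
Proof.
elim: s occ => //= p s IHs occ eocc; rewrite inE => /norP[ne es].
rewrite IHs ?inE ?negb_or ?ne // andbT; apply/implyP => le_pe.
have /andP[-> le_e] := cstep_between eocc le_pe.
by rewrite ltn_neqAle le_e andbT eq_sym; move: ne; rewrite -val_eqE.
Qed.

Lemma parking_function_cpark s : size s = n ->
  parking_function (map val s) = (0 \notin cpark [::] s).
Proof.
move=> sz; have us : uniq (map val (cpark [::] s)).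
  rewrite (map_inj_uniq val_inj) -[cpark _ _]cats0 uniq_cpark //= sz; lia.
have szc := size_cpark [::] s.
apply/parking_function_count/idP => [[s0 H]|s0].
  (* If 0 is taken, some e > 0 is free, and the cars preferring one of 1, ..., e all park in 1, ...,
     e-1: there are fewer than e of them. *)
  apply/negP => c0.
  have [|e e_free] := @ex_free (cpark [::] s); first by rewrite szc sz.
  have e_gt0 : (0 < e)%N.
    rewrite lt0n; apply: contraNneq e_free => e0.
    by rewrite (_ : e = 0) //; apply: val_inj.
  have := H e; rewrite e_gt0 size_map sz -ltnS ltn_ord => /(_ isT).
  apply/negP; rewrite -ltnNge -[X in (_ < X)%N](prednK e_gt0) ltnS.
  rewrite count_map.
  have all2s : all2 (fun p o : 'I_n.+1 => (p <= e) ==> (0 < o < e))%N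
      s (cpark [::] s).
    have {s0} := s0; have := @all2_cpark_between e [::] s isT e_free.
    elim: s (cpark [::] s) {H sz us szc c0 e_free} => [|p s IHs] [|o c] //=.
    case/andP=> Hp /IHs{}IHs; rewrite inE => /norP[p0 /IHs->].
    rewrite andbT; apply/implyP => /(implyP Hp); lia.
  apply: leq_trans (@count_all2 _ _ _ _
    (fun o : 'I_n.+1 => (0 < o < e)%N) _ _ _ all2s) _.
    by move=> p o /implyP.
  rewrite -(count_map val (fun o => (0 < o < e)%N)).
  by apply: (@count_uniq_range _ 1) => // i _; lia.
have [_ all2s] := @park_cpark [::] s isT s0.
split.
  apply/count_memPn/eqP; rewrite -leqn0 count_map.
  apply: leq_trans (@count_all2 _ _ _ _ pred0 _ _ _ all2s) _.
    by move=> p o /andP[p_gt0 _] /= /eqP p0; rewrite p0 in p_gt0.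
  by rewrite count_pred0.
move=> j; rewrite size_map sz => /andP[j0 le_j].
(* Nobody parks before the preferred spot, so cars preferring a spot beyond j share the n - j spots
   beyond j. *)
have le_gt : (count (fun p : nat => j < p) (map val s) <= n - j)%N.
  rewrite count_map.
  apply: leq_trans (@count_all2 _ _ _ _
    (fun o : 'I_n.+1 => (j < o)%N) _ _ _ all2s) _.
    by move=> p o /andP[_ le_po] /= lt_j; apply: leq_trans lt_j le_po.
  rewrite -(count_map val (fun o => (j < o)%N)).
  apply: (@count_uniq_range _ j.+1) => // i /mapP[o _ ->] /= ->.
  by have := ltn_ord o; lia.
have := count_predC (geq j) (map val s); rewrite size_map sz.
rewrite (@eq_count _ (predC (geq j)) (fun p : nat => (j < p)%N)); first lia.
by move=> p /=; rewrite -ltnNge.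
Qed.

(** * Invariance under rotation *)

Lemma cstepD (c : 'I_n.+1) occ p :
  cstep (map (+%R c) occ) (c + p) = c + cstep occ p.
Proof.
rewrite /cstep -addrA; congr (_ + (_ + inZp _)); apply: eq_find => k.
by rewrite -addrA (mem_map (addrI c)).
Qed.

Lemma cparkD (c : 'I_n.+1) occ s :
  cpark (map (+%R c) occ) (map (+%R c) s) = map (+%R c) (cpark occ s).
Proof. by elim: s occ => //= p s IHs occ; rewrite cstepD -map_cons IHs. Qed.

Lemma cunlD (c : 'I_n.+1) s : cunl [::] (map (+%R c) s) = cunl [::] s.
Proof.
rewrite /cunl -[[::]]/(map (+%R c) [::]) cparkD count_zip_map.
by apply: eq_count => u /=; rewrite (inj_eq (addrI c)).
Qed.

Lemma unl_cunl s : size s = n -> 0 \notin cpark [::] s ->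
  unl (map val s) = cunl [::] s.
Proof.
move=> sz s0; rewrite /unl /outcome size_map sz.
have [-> _] := @park_cpark [::] s isT s0; rewrite count_zip_map.
by apply: eq_count => u /=; rewrite -val_eqE.
Qed.

Lemma cunl_cons occ p s : (size occ <= n)%N ->
  cunl occ (p :: s) = ((p \in occ) + cunl (cstep occ p :: occ) s)%N.
Proof. by case/ex_free=> q qocc; rewrite /cunl /= (cstep_neq p qocc). Qed.

Lemma card_free s : size s = n ->
  #|[pred c : 'I_n.+1 | c \notin cpark [::] s]| = 1%N.
Proof.
move=> sz; have := cardC (mem (cpark [::] s)).
rewrite card_ord (card_uniqP _) ?size_cpark ?sz => [E|].
  by apply: (@addnI n); rewrite [RHS]addn1 -[RHS]E; congr addn; apply: eq_card.
by rewrite -[cpark _ _]cats0 uniq_cpark //= sz.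
Qed.

Lemma sum_rotation (V : nmodType) (F : seq 'I_n.+1 -> V) : (0 < n)%N ->
  (forall (c : 'I_n.+1) s, size s = n -> F (map (+%R c) s) = F s) ->
  \sum_(t : n.-tuple 'I_n.+1 | 0 \notin cpark [::] t) F t =
  \sum_(t : n.-tuple 'I_n.+1 | nth 0 t 0 == 0) F t.
Proof.
move=> n_gt0 FD; rewrite (partition_big (fun t => nth 0 (val t) 0) xpredT) //=.
(* Split by the first entry [c] and rotate it to 0: the condition that 0 stays free becomes that
   [- c] stays free, which by [card_free] holds for exactly one [c]. *)
transitivity (\sum_(c : 'I_n.+1) \sum_(t : n.-tuple 'I_n.+1 | nth 0 t 0 == 0)
                if - c \notin cpark [::] t then F t else 0).
  apply: eq_bigr => c _; rewrite -big_mkcondr.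
  rewrite (reindex (fun t : n.-tuple 'I_n.+1 => map_tuple (+%R c) t)) /=.
    apply: eq_big => [t|t _]; last by rewrite FD ?size_tuple.
    rewrite -[[::]]/(map (+%R c) [::]) cparkD -[X in X \notin _](subrr c).
    rewrite (mem_map (addrI c)) andbC (nth_map 0) ?size_tuple //.
    by rewrite -[X in _ == X]addr0 (inj_eq (addrI c)).
  apply: onW_bij; exists (map_tuple (+%R (- c))) => t; apply: val_inj => /=.
    by rewrite (mapK (addKr c)).
  by rewrite (mapK (addNKr c)).
rewrite exchange_big /=; apply: eq_bigr => t _.
rewrite -big_mkcond (reindex_inj oppr_inj) /=.
under eq_bigl do rewrite opprK.
by rewrite sumr_const card_free ?size_tuple.
Qed.

(** * Summing over the preferences car by car *)

Section Sums.

Variables (R : comNzRingType) (x y z : R).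

(* The sum of x^[p = a] y^[p = b] z^[p occupied] over all spots p when k spots,
   including a and b, are occupied. *)
Definition step_weight (a b : 'I_n.+1) (k : nat) : R :=
  (if a == b then x * y - 1 else x + y - 2) * z + k%:R * z + (n.+1 - k)%:R.

Lemma sum_step (a b : 'I_n.+1) occ : uniq occ -> a \in occ -> b \in occ ->
  \sum_p x ^+ (p == a) * y ^+ (p == b) * z ^+ (p \in occ) =
  step_weight a b (size occ).
Proof.
move=> uocc aocc bocc; rewrite (bigID (mem occ)) /=; congr (_ + _); last first.
  rewrite (eq_bigr (fun=> 1)) => [|p pocc]; last first.
    have neq (c : 'I_n.+1) : c \in occ -> (p == c) = false.
      by move=> cocc; apply: contraNF pocc => /eqP->.
    by rewrite !neq // (negbTE pocc) !expr0 !mulr1.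
  rewrite sumr_const; congr (_ *+ _).
  have := cardC (mem occ); rewrite card_ord (card_uniqP _) // => E.
  rewrite -[LHS](addKn (size occ)); congr (_ - _)%N.
  by rewrite -[RHS]E; congr addn; apply: eq_card.
(* With one z per occupied spot on the right, the two sides differ termwise only at [a] and [b],
   which the first summand of [step_weight] corrects. *)
have -> : (size occ)%:R * z = \sum_(p in occ) z.
  by rewrite sumr_const (card_uniqP _) // mulr_natl.
rewrite [in LHS](bigD1 a) // [in RHS](bigD1 a) //= eqxx aocc.
case: eqVneq => [<-|neq_ab].
  rewrite [X in _ + X = _](eq_bigr (fun=> z)); first ring.
  by move=> p /andP[-> /negbTE->]; rewrite !mul1r.
rewrite [in LHS](bigD1 b) /= ?bocc 1?eq_sym //.
rewrite [in RHS](bigD1 b) /= ?bocc 1?eq_sym //.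
rewrite eqxx (eq_sym b) (negbTE neq_ab).
rewrite [X in _ + (_ + X) = _](eq_bigr (fun=> z)); first ring.
by move=> p /andP[/andP[-> /negbTE->] /negbTE->]; rewrite !mul1r.
Qed.

Lemma sum_tuple_cons (T : finType) (m : nat) (F : m.+1.-tuple T -> R) :
  \sum_t F t = \sum_p \sum_t F (cons_tuple p t).
Proof.
rewrite pair_bigA (reindex (fun u : T * m.-tuple T => cons_tuple u.1 u.2)) //=.
apply: onW_bij; exists (fun t : m.+1.-tuple T => (thead t, behead_tuple t)).
  by case=> p t; rewrite theadE; congr (_, _); apply: val_inj.
by move=> t; rewrite [RHS]tuple_eta; apply: val_inj.
Qed.

(** Whatever the next car prefers, it fills one more spot and [a], [b] remain occupied; so the sum
    over the later cars is the same for every preference and factors out. *)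
Lemma sum_cunl (a b : 'I_n.+1) (m : nat) occ :
  uniq occ -> a \in occ -> b \in occ -> (size occ + m <= n.+1)%N ->
  \sum_(t : m.-tuple 'I_n.+1)
     x ^+ count_mem a t * y ^+ count_mem b t * z ^+ cunl occ t =
  \prod_(0 <= i < m) step_weight a b (size occ + i).
Proof.
elim: m occ => [|m IHm] occ uocc aocc bocc le_n.
  rewrite big_geq // (bigD1 [tuple]) //= big1 ?addr0 ?mulr1 // => t.
  by case/eqP; apply: tuple0.
have lt_n : (size occ <= n)%N by lia.
rewrite sum_tuple_cons big_nat_recl // addn0 -(sum_step uocc aocc bocc).
rewrite big_distrl /=; apply: eq_bigr => p _.
have [q qocc] := ex_free lt_n.
have := IHm (cstep occ p :: occ); rewrite /= (cstep_notin p qocc) uocc.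
rewrite !inE aocc bocc !orbT => /(_ isT isT isT) IH.
under eq_big_nat do rewrite addnS -addSn.
rewrite -IH; last lia.
rewrite big_distrr /=; apply: eq_bigr => t _.
by rewrite cunl_cons // !exprD; ring.
Qed.

End Sums.

End CircularParking.

(** * Assembling the generating function *)

Theorem theorem4p9 (R : comNzRingType) (n : nat) (x y z : R) (hn : (2 <= n)%N) :
  \sum_(t in PF n)
     x ^+ lel (prefs t) * y ^+ nlel (prefs t) * z ^+ unl (prefs t) =
  x * y *
    (n%:R * \prod_(1 <= i < n.-1)
              (x * z + y * z + (i - 1)%:R * z + (n - i)%:R)
     + x * y * z * \prod_(1 <= i < n.-1)
                     (x * y * z + i%:R * z + (n - i)%:R)).
Proof.
case: n hn => [|[|m]] // _; set n := m.+2.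
pose G (s : seq 'I_n.+1) : R :=
  x ^+ count_mem (nth 0 s 0) s * y ^+ count_mem (nth 0 s 1) s * z ^+ cunl [::] s.
have GD c t : size t = n -> G (map (+%R c) t) = G t.
  move=> sz.
  have cnt k : (k < n)%N ->
      count_mem (nth 0 (map (+%R c) t) k) (map (+%R c) t) = count_mem (nth 0 t k) t.
    move=> lt_k; rewrite (nth_map 0) ?sz // count_map.
    by apply: eq_count => p /=; rewrite (inj_eq (addrI c)).
  by rewrite /G cunlD !cnt.
transitivity (\sum_(t : n.-tuple 'I_n.+1 | 0 \notin cpark [::] t) G t).
  apply: eq_big => [t|t]; rewrite inE /prefs parking_function_cpark ?size_tuple //.
  move=> t0; rewrite /G unl_cunl ?size_tuple // /lel /nlel.
  by rewrite !(nth_map 0) ?size_tuple // !count_map.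
rewrite sum_rotation // big_mkcond sum_tuple_cons.
rewrite (bigD1 0) //= [X in _ + X]big1 ?addr0; last first.
  by move=> p p0; apply: big1 => t _; rewrite (negbTE p0).
rewrite sum_tuple_cons.
(* Here [b] is the second preference. The first car is lucky at 0; the second is unlucky exactly
   when b = 0, and then both preferences count twice, giving the extra x y z. *)
transitivity (\sum_(b : 'I_n.+1) x * y * (if b == 0 then x * y * z else 1) *
   \prod_(0 <= i < m) step_weight x y z 0 b (2 + i)).
  have [q free_q] := @ex_free n [:: 0] isT.
  apply: eq_bigr => b _; rewrite -(@sum_cunl _ _ x y z 0 b m [:: cstep [:: 0] b; 0]).
  - rewrite big_distrr /=; apply: eq_bigr => t _.
    have c0 : cstep [::] (0 : 'I_n.+1) = 0.
      by have /negbFE/eqP := @cstep_neq n [::] 0 0 isT.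
    rewrite /G /= !cunl_cons // c0 !inE eqxx (eq_sym 0) in_nil.
    by case: (eqVneq b 0) => [->|_]; rewrite !exprD; ring.
  - by rewrite /= andbT (cstep_notin b free_q).
  - by rewrite !inE eqxx orbT.
  (* Spot [b] is occupied after two cars: by the first if b = 0, otherwise by the second. *)
  - rewrite !inE; have := cstep_neq b free_q; rewrite inE eq_sym.
    by case: (b == 0) => [_|/negbFE->]; rewrite ?orbT.
  - by [].
(* The n nonzero values of [b] contribute equally, which gives the factor n; b = 0 gives the other
   product. Index i of the products in the statement corresponds to i + 1 occupied spots. *)
rewrite (bigD1 0) //= addrC mulrDr; congr (_ + _).
  rewrite (eq_bigr (fun=> x * y * \prod_(1 <= i < n.-1)
              (x * z + y * z + (i - 1)%:R * z + (n - i)%:R))).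
    rewrite sumr_const (@eq_card _ _ (predC1 0)) // cardC1 card_ord.
    by rewrite [RHS]mulrCA mulr_natl.
  move=> b /negbTE b0; rewrite b0 mulr1 big_add1; congr (_ * _).
  apply: eq_bigr => i _; rewrite /step_weight eq_sym b0 subn1 subSS natrD; ring.
rewrite [RHS]mulrA big_add1; congr (_ * _).
apply: eq_bigr => i _; rewrite /step_weight eqxx subSS natrD -addn1 natrD; ring.
Qed.
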